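(* Let $\mathfrak M=(n,\mathcal G,\{P_i,r_i\}_{i=1}^n)$ be a problem instance with transition parameters $(e_i,f_i,g_i,h_i,e_i',f_i',g_i',h_i')_{i=1}^n$. Suppose that for all $i$, $$e_i-f_i=g_i-h_i\in(-1,1),\qquad e_i-f_i'=g_i-h_i'\in(-1,1),$$ $$e_i'-f_i=g_i'-h_i\in(-1,1),\qquad e_i'-f_i'=g_i'-h_i'\in(-1,1),$$ and that there is $\rho\in(0,1)$ such that for all $i$, $$\max\left\{\left|\frac{e_i-g_i}{1-(e_i-f_i)}\right|,\ \left|\frac{e_i-g_i}{1-(e_i-f_i')}\right|,\ \left|\frac{e_i'-g_i'}{1-(e_i'-f_i)}\right|,\ \left|\frac{e_i'-g_i'}{1-(e_i'-f_i')}\right|\right\}\le\rho .$$ Then $\mathfrak M$ has the $(2,\rho)$-fast decaying property; that is, for every node $i$, every local policy $\zeta\in\Gamma$ and every integer $k\ge1$, $$\|\pi_i(\zeta)-\hat\pi_i^k(\zeta_{\Delta_i^k})\|_1\le 2\rho^k .$$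
   Context: **Problem instance.** There are $n$ agents $\mathcal N=\{1,\dots,n\}$; agent $i$ has state $s_i\in\{0,1\}$ and action $a_i\in\{0,1\}$. $\mathcal G$ is a directed tree on $\mathcal N$ rooted at node $1$. For a node $i$, $\delta_i^1$ is its parent and $\delta_i^k$ its $k$-hop parent (ancestor at distance $k$). $\Delta_i^k=(i,\delta_i^1,\dots,\delta_i^k)$ is the path from $i$ to its $k$-hop parent; if $i$ has no $k$-hop parent, $\Delta_i^k$ is the path from $i$ to the root. Given global state $s(t)$ and action $a(t)$, the next states are independent across agents: $$P(s(t+1)\mid s(t),a(t))=\prod_{i=1}^n P_i(s_i(t+1)\mid s_i(t),s_{\delta_i^1}(t),a_i(t)),$$ where for the root $i=1$ the factor is $P_1(s_1(t+1)\mid s_1(t),a_1(t))$. (The rewards $r_i:\{0,1\}\to\mathbb R$ play no role here.) **Transition parameters.** Rows are indexed by $s_i(t)=0,1$ and columns by $s_i(t+1)=0,1$, in this order: $$P_i(\cdot\mid\cdot,s_{\delta_i^1}(t)=0,a_i(t)=0)=\begin{pmatrix}e_i&1-e_i\\ f_i&1-f_i\end{pmatrix},\quad P_i(\cdot\mid\cdot,s_{\delta_i^1}(t)=1,a_i(t)=0)=\begin{pmatrix}g_i&1-g_i\\ h_i&1-h_i\end{pmatrix},$$ $$P_i(\cdot\mid\cdot,s_{\delta_i^1}(t)=0,a_i(t)=1)=\begin{pmatrix}e_i'&1-e_i'\\ f_i'&1-f_i'\end{pmatrix},\quad P_i(\cdot\mid\cdot,s_{\delta_i^1}(t)=1,a_i(t)=1)=\begin{pmatrix}g_i'&1-g_i'\\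 h_i'&1-h_i'\end{pmatrix}.$$ For the root, which has no parent, set $g_1=e_1$, $h_1=f_1$, $g_1'=e_1'$, $h_1'=f_1'$. All parameters lie in $[0,1]$. **Local policies.** $\Gamma_i$ is the set of all $4$ maps $\zeta_i:\{0,1\}\to\{0,1\}$ (agent $i$ plays $a_i(t)=\zeta_i(s_i(t))$), and $\Gamma=\Gamma_1\times\cdots\times\Gamma_n$. For a tuple of nodes $D$, $\zeta_D=(\zeta_j)_{j\in D}$. **Standing assumption.** For each $i$, each $\zeta_i\in\Gamma_i$ and each fixed parent state $u\in\{0,1\}$, the two-state chain with transition matrix $P_i(s_i(t+1)\mid s_i(t),s_{\delta_i^1}(t)=u,a_i(t)=\zeta_i(s_i(t)))$ is ergodic. Here a finite chain is called ergodic if $1$ is a simple eigenvalue of its transition matrix and all other eigenvalues have modulus $<1$; under the hypotheses of the claim this assumption holds automatically. Consequently, under every $\zeta\in\Gamma$ the global chain has a unique stationary distribution $\pi(\zeta)$; $\pi_i(\zeta)$ denotes its marginal on $s_i$. **Truncated model.** For node $i$ and integer $k\ge1$, the truncated model is the Markov chain on $(s_j)_{j\in\Delta_i^k}$ in which, if $i$ has a $k$-hop parent, the nodes $i,\delta_i^1,\dots,\delta_i^{k-1}$ evolve with their original transition probabilities (independently given the current states), and $s_{\delta_i^k}(t)$ is drawn uniformly from $\{0,1\}$ at every time, independently of everything else. If $i$ has no $k$-hop parent, all nodes on the path from $i$ to the root evolve with their original transition probabilities (nothing is truncated). Under policies $\zeta_{\Delta_i^k}$, $\hat\pi_i^k(\zeta_{\Delta_i^k})$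 is the marginal on $s_i$ of the stationary distribution of this chain. *)

(* Defs.v *)
From HB Require Import structures.
From mathcomp Require Import all_boot all_order all_algebra.
From mathcomp Require Import reals.

Set Implicit Arguments.
Unset Strict Implicit.
Unset Printing Implicit Defensive.

Import Order.TTheory GRing.Theory Num.Theory.
Local Open Scope ring_scope.

(* Edges point from parent to child: every node is reachable from r, r has no
   in-neighbour and every other node has exactly one. *)
Definition rooted_tree (V : finType) (r : V) (edge : rel V) : Prop :=
  (forall v, connect edge r v) /\
  (forall v, #|[set u | edge u v]| = (v != r) :> nat).

Definition in01 (R : realType) (x : R) : Prop := 0 <= x <= 1.

(* The agents are 'I_n.+1 (a rooted tree is nonempty) and the root is ord0.
   The last four equations are the convention for the parentless root. *)
Record instance (R : realType) (n : nat) := Instance {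
  edge : rel 'I_n.+1;
  edge_tree : rooted_tree ord0 edge;
  te : 'I_n.+1 -> R; tf : 'I_n.+1 -> R;
  tg : 'I_n.+1 -> R; th : 'I_n.+1 -> R;
  te' : 'I_n.+1 -> R; tf' : 'I_n.+1 -> R;
  tg' : 'I_n.+1 -> R; th' : 'I_n.+1 -> R;
  reward : 'I_n.+1 -> bool -> R;
  t01 : forall i, [/\ in01 (te i), in01 (tf i), in01 (tg i) & in01 (th i)];
  t01' : forall i, [/\ in01 (te' i), in01 (tf' i), in01 (tg' i) & in01 (th' i)];
  root_eg : tg ord0 = te ord0;
  root_fh : th ord0 = tf ord0;
  root_eg' : tg' ord0 = te' ord0;
  root_fh' : th' ord0 = tf' ord0
}.

Definition policy (V : Type) := V -> bool -> bool.

Section Chains.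
Variable R : realType.

Definition stationary (S : finType) (K : S -> S -> R) (mu : S -> R) : Prop :=
  [/\ forall x, 0 <= mu x, \sum_x mu x = 1
    & forall y, \sum_x mu x * K x y = mu y].

Definition marginal (V : finType) (mu : {ffun V -> bool} -> R) (i : V)
    (b : bool) : R :=
  \sum_(s : {ffun V -> bool} | s i == b) mu s.

Definition norm1 (p : bool -> R) : R := \sum_(b : bool) `|p b|.

Variables (n : nat) (M : instance R n).
Implicit Types (i : 'I_n.+1) (k : nat).

Definition parent i : option 'I_n.+1 := [pick j | edge M j i].

Definition hop_parent i k : option 'I_n.+1 := iter k (obind parent) (Some i).

(* The nodes of the path from i to its k-hop parent, or to the root when there
   is no k-hop parent. *)
Definition path_to i k : {set 'I_n.+1} :=
  [set j | [exists m : 'I_k.+1, hop_parent i m == Some j]].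

Lemma self_path_to i k : i \in path_to i k.
Proof. by rewrite inE; apply/existsP; exists ord0. Qed.

(* Probability that agent i moves to state 0 (= false) from state x under
   action a, the parent being in state u (None for the root, for which the
   te/tf and tg/th rows agree). *)
Definition prob0 i (x : bool) (u : option bool) (a : bool) : R :=
  match odflt false u, a, x with
  | false, false, false => te M i
  | false, false, true => tf M i
  | true, false, false => tg M i
  | true, false, true => th M i
  | false, true, false => te' M i
  | false, true, true => tf' M i
  | true, true, false => tg' M i
  | true, true, true => th' M i
  end.

Definition local_kernel i (x : bool) (u : option bool) (a x' : bool) : R :=
  if x' then 1 - prob0 i x u a else prob0 i x u a.

Definition global_kernel (zeta : policy 'I_n.+1) (s s' : {ffun 'I_n.+1 -> bool})
    : R :=
  \prod_i local_kernel i (s i) (omap s (parent i)) (zeta i (s i)) (s' i).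

Definition path_node i k := {j : 'I_n.+1 | j \in path_to i k}.

Definition path_parent i k (j : path_node i k) : option (path_node i k) :=
  obind insub (parent (val j)).

(* The k-hop parent of i, if it exists, is redrawn uniformly at every step. *)
Definition truncated_kernel i k (zeta : policy (path_node i k))
    (s s' : {ffun path_node i k -> bool}) : R :=
  \prod_(j : path_node i k)
    if hop_parent i k == Some (val j) then 2^-1
    else local_kernel (val j) (s j) (omap s (path_parent j)) (zeta j (s j))
           (s' j).

Definition start_node i k : path_node i k := Sub i (self_path_to i k).

(* mu and nu range over all stationary distributions of the two finite chains:
   they always exist, and in the ergodic case each is unique. *)
Definition fast_decaying (c rho : R) : Prop :=
  forall i (zeta : policy 'I_n.+1) k, (1 <= k)%N ->
  forall mu, stationary (global_kernel zeta) mu ->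
  forall nu, stationary (truncated_kernel (fun j : path_node i k => zeta (val j)))
               nu ->
  norm1 (fun b => marginal mu i b - marginal nu (start_node i k) b)
    <= c * rho ^+ k.

End Chains.

(* Main.v *)
Require Import Defs.
From mathcomp Require Import all_boot all_order all_algebra.
From mathcomp Require Import reals ring lra.

Import Order.TTheory GRing.Theory Num.Theory.
Local Open Scope ring_scope.

(** Fix a policy.  The hypotheses say that the probability that an agent moves
to state 1 is an affine function [c + slope * x + shift * u] of its own state
[x] and its parent's state [u], without a cross term [x * u].  Expectations of
an affine function only involve expectations of the coordinates, so that at
stationarity the mean [m] of an agent's state is determined by the mean [m'] of
its parent's state, by [m = c + slope * m + shift * m'] ([stationary_mean]),
although the states of the two agents are in general correlated.

The same equation, with the same coefficients, holds in the global chain and in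
the truncated chain for each agent that is not redrawn.  Subtracting the two,
the gap between the means at an agent is [shift / (1 - slope)] times the gap at
its parent, a factor of absolute value at most [rho]
([stationary_mean_contraction]); it is zero at an agent without parent.
Climbing from [i] to its [k]-hop parent, where the gap is at most 1, gives a
gap of at most [rho ^+ k] at [i].  Each of the two states contributes this gap
to the l1 norm, whence the constant 2.

The mean equation fails at the redrawn [k]-hop parent; that it is not one of
the agents met before it on the climb comes from the absence of cycles
([hop_parent_inj]). *)

(** * Stationary distributions of product kernels *)

(** Summing the product kernel over the configurations with a prescribed
coordinate [i] leaves the factor of [i], the others having total mass 1. *)
Lemma sum_prod_coord {R : realType} {V : finType} (F : V -> bool -> R) (i : V)
    (b : bool) :
  (forall j, \sum_c F j c = 1) ->
  \sum_(s : {ffun V -> bool} | s i == b) \prod_j F j (s j) = F i b.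
Proof.
move=> F1; pose Q j : pred bool := fun c => (j == i) ==> (c == b).
transitivity (\sum_(s in family Q) \prod_j F j (s j)).
  apply: eq_bigl => s; apply/idP/familyP => [/eqP si j|/(_ i)].
    by rewrite unfold_in; apply/implyP => /eqP ->; apply/eqP.
  by rewrite unfold_in /Q eqxx.
rewrite -bigA_distr_big_dep (bigD1 i) //=.
rewrite [X in _ * X]big1 ?mulr1 => [|j ji].
  by rewrite (big_pred1 b) // => c; rewrite /Q eqxx.
by rewrite -[RHS](F1 j); apply: eq_bigl => c; rewrite /Q (negPf ji).
Qed.

(** One step of the chain leaves the law of coordinate [i] unchanged; the other
factors of the kernel sum out, whatever the configuration they depend on. *)
Lemma stationary_marginal {R : realType} {V : finType}
    (q : V -> {ffun V -> bool} -> bool -> R) (mu : {ffun V -> bool} -> R)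
    (i : V) (b : bool) :
  (forall j s, \sum_c q j s c = 1) ->
  stationary (fun s s' => \prod_j q j s (s' j)) mu ->
  marginal mu i b = \sum_s mu s * q i s b.
Proof.
move=> q1 [_ _ mu_inv]; rewrite /marginal.
under eq_bigr do rewrite -mu_inv.
rewrite exchange_big /=; apply: eq_bigr => s _.
by rewrite -big_distrr /= (sum_prod_coord (fun j => q j s)).
Qed.

Lemma marginal_ge0 {R : realType} {V : finType} (mu : {ffun V -> bool} -> R) i b :
  (forall s, 0 <= mu s) -> 0 <= marginal mu i b.
Proof. by move=> mu0; apply: sumr_ge0. Qed.

Lemma marginal_total {R : realType} {V : finType} (mu : {ffun V -> bool} -> R) i :
  \sum_s mu s = 1 -> marginal mu i false = 1 - marginal mu i true.
Proof.
move=> <-; rewrite (bigID (fun s : {ffun V -> bool} => s i == true)) /=.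
rewrite addrC addrK; apply: eq_bigl => s; by case: (s i).
Qed.

Lemma marginal_mean {R : realType} {V : finType} (mu : {ffun V -> bool} -> R) i :
  marginal mu i true = \sum_s mu s * (s i)%:R.
Proof.
rewrite /marginal big_mkcond; apply: eq_bigr => s _.
by case: (s i); rewrite ?mulr1 ?mulr0.
Qed.

(** * One agent and its parent *)

Section Agent.
Context {R : realType} {n : nat} (M : instance R n).
Implicit Types (j : 'I_n.+1) (z : bool -> bool).

(** [z] is the local policy, so a change of the agent's state changes its action
too.  A missing parent counts as a parent in state 0, as in [prob0]. *)
Definition slope j z : R :=
  prob0 M j false None (z false) - prob0 M j true None (z true).

Definition shift j z : R :=
  prob0 M j false None (z false) - prob0 M j false (Some true) (z false).

(** The absence of a cross term: the effect of the agent's own state on the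
transition probability is the same for both parent states. *)
Definition affine_agent j z : Prop :=
  slope j z =
  prob0 M j false (Some true) (z false) - prob0 M j true (Some true) (z true).

Lemma local_kernel_total j x u a : \sum_c local_kernel M j x u a c = 1.
Proof. by rewrite big_bool /=; ring. Qed.

Lemma local_kernel_affine j z x u : affine_agent j z ->
  local_kernel M j x u (z x) true =
  1 - prob0 M j false None (z false)
    + slope j z * x%:R + shift j z * (odflt false u)%:R.
Proof.
rewrite /affine_agent /slope /shift /local_kernel.
have pN y a : prob0 M j y None a = prob0 M j y (Some false) a by [].
by case: u => [[]|]; case: x => /=; rewrite ?pN /=; lra.
Qed.

(** Because the transition probability is affine, no joint law of the two states
enters, only the two means.  The vertices [v] and [up] are separate from the
agent [j] so that the equation applies to both chains, whose vertex types
differ. *)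
Lemma stationary_mean {V : finType} (mu : {ffun V -> bool} -> R) j z (v : V)
    (up : option V) :
  affine_agent j z -> \sum_s mu s = 1 ->
  marginal mu v true =
    \sum_s mu s * local_kernel M j (s v) (omap s up) (z (s v)) true ->
  (1 - slope j z) * marginal mu v true =
    1 - prob0 M j false None (z false)
      + shift j z * oapp (fun w => marginal mu w true) 0 up.
Proof.
move=> aff mu1 mean_v; set c := 1 - prob0 _ _ _ _ _.
have mean_up : \sum_s mu s * (odflt false (omap s up))%:R =
               oapp (fun w => marginal mu w true) 0 up.
  case: up {mean_v} => [w|] /=; first by rewrite marginal_mean.
  by rewrite big1 // => s _; rewrite mulr0.
have -> : c = c * \sum_s mu s by rewrite mu1 mulr1.
rewrite -mean_up mulrBl mul1r {1}mean_v marginal_mean !mulr_sumr.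
rewrite -sumrB -big_split; apply: eq_bigr => s _.
by rewrite (local_kernel_affine j z) // -/c /=; ring.
Qed.

(** The constant term of the mean equation is common to both chains and cancels
in the difference. *)
Lemma stationary_mean_contraction {V W : finType}
    (mu : {ffun V -> bool} -> R) (nu : {ffun W -> bool} -> R) (rho : R) j z
    (v : V) (up : option V) (w : W) (up' : option W) :
  affine_agent j z -> slope j z < 1 -> `|shift j z / (1 - slope j z)| <= rho ->
  \sum_s mu s = 1 -> \sum_s nu s = 1 ->
  marginal mu v true =
    \sum_s mu s * local_kernel M j (s v) (omap s up) (z (s v)) true ->
  marginal nu w true =
    \sum_s nu s * local_kernel M j (s w) (omap s up') (z (s w)) true ->
  `|marginal mu v true - marginal nu w true| <=
    rho * `|oapp (fun x => marginal mu x true) 0 up -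
            oapp (fun x => marginal nu x true) 0 up'|.
Proof.
move=> aff slope1 shift_rho mu1 nu1 mean_v mean_w.
have := stationary_mean mu j z v up aff mu1 mean_v.
have := stationary_mean nu j z w up' aff nu1 mean_w.
move: (oapp _ _ up) (oapp _ _ up') (marginal mu _ _) (marginal nu _ _).
move=> x y m m' eq_m' eq_m.
have slope_neq1 : 1 - slope j z != 0 by rewrite subr_eq0 eq_sym lt_eqF.
have -> : m - m' = shift j z / (1 - slope j z) * (x - y).
  by apply: (mulfI slope_neq1); rewrite mulrBr eq_m eq_m'; field.
by rewrite normrM ler_wpM2r.
Qed.
End Agent.

(** * Paths to the root *)

Section Paths.
Context {R : realType} {n : nat} (M : instance R n).
Implicit Types (i j : 'I_n.+1) (k m : nat).

Lemma parent_edge i j : edge M j i -> parent M i = Some j.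
Proof.
move=> ji; rewrite /parent; case: pickP => [u ui|/(_ j)]; last by rewrite ji.
congr Some; have [_ /(_ i) indeg] := edge_tree M.
have /card_le1_eqP: (#|[set u | edge M u i]| <= 1)%N by rewrite indeg leq_b1.
by apply; rewrite inE.
Qed.

Lemma parent_root : parent M ord0 = None.
Proof.
rewrite /parent; case: pickP => // u u0; have [_ /(_ ord0)] := edge_tree M.
by rewrite eqxx => /eqP; rewrite cards_eq0 => /eqP/setP/(_ u); rewrite !inE u0.
Qed.

Lemma hop_parentS i k : hop_parent M i k.+1 = obind (parent M) (hop_parent M i k).
Proof. by []. Qed.

Lemma hop_parentD i m k :
  hop_parent M i (m + k) = obind (hop_parent M ^~ k) (hop_parent M i m).
Proof.
elim: k => [|k IH]; first by rewrite addn0; case: hop_parent.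
by rewrite addnS hop_parentS IH; case: (hop_parent M i m).
Qed.

Lemma hop_parent_root i : exists k, hop_parent M i k = Some ord0.
Proof.
have [/(_ i)/connectP[p + ->] _] := edge_tree M.
elim/last_ind: p => [|p j IH]; first by exists 0.
rewrite rcons_path last_rcons => /andP[/IH[k hop_k] /parent_edge par_j].
by exists k.+1; rewrite -(add1n k) hop_parentD /hop_parent /= par_j.
Qed.

(** A repetition would make some agent its own ancestor, so that climbing from
it never ends; but climbing from any agent leaves the tree above the root. *)
Lemma hop_parent_inj i j m k :
  (m < k)%N -> hop_parent M i m = Some j -> hop_parent M i k != Some j.
Proof.
move=> mk hop_m; apply/eqP => hop_k; have [l hop_l] := hop_parent_root j.
have loop q : hop_parent M j (q * (k - m)) = Some j.
  elim: q => [//|q IH]; rewrite mulSn addnC hop_parentD IH /=.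
  by move: hop_k; rewrite -{1}(subnKC (ltnW mk)) hop_parentD hop_m.
have stop d : hop_parent M j (l.+1 + d) = None.
  by rewrite hop_parentD hop_parentS hop_l /= parent_root.
have := loop l.+1; rewrite -(subnKC (_ : l.+1 <= l.+1 * (k - m))%N) ?stop //.
by rewrite leq_pmulr // subn_gt0.
Qed.

Lemma mem_path_to i j m k :
  (m <= k)%N -> hop_parent M i m = Some j -> j \in path_to M i k.
Proof.
rewrite -ltnS => mk hop_m; rewrite inE; apply/existsP.
by exists (Ordinal mk); apply/eqP.
Qed.
End Paths.

(** * The two chains *)

Section Decay.
Context {R : realType} {n : nat} (M : instance R n).
Variables (zeta : policy 'I_n.+1) (i : 'I_n.+1) (k : nat).
Variables (mu : {ffun 'I_n.+1 -> bool} -> R).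
Variables (nu : {ffun path_node M i k -> bool} -> R).
Hypothesis mu_stat : stationary (global_kernel M zeta) mu.
Hypothesis nu_stat :
  stationary (truncated_kernel (fun j : path_node M i k => zeta (val j))) nu.

Lemma global_marginal j b :
  marginal mu j b =
  \sum_s mu s * local_kernel M j (s j) (omap s (parent M j)) (zeta j (s j)) b.
Proof.
pose q j (s : {ffun 'I_n.+1 -> bool}) :=
  local_kernel M j (s j) (omap s (parent M j)) (zeta j (s j)).
apply: (stationary_marginal q) => // l s; exact: local_kernel_total.
Qed.

Lemma truncated_marginal (y : path_node M i k) b :
  marginal nu y b =
  \sum_s nu s *
    (if hop_parent M i k == Some (val y) then 2^-1
     else local_kernel M (val y) (s y) (omap s (path_parent y))
            (zeta (val y) (s y)) b).
Proof.
pose q (j : path_node M i k) (s : {ffun path_node M i k -> bool}) c : R :=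
  if hop_parent M i k == Some (val j) then 2^-1
  else local_kernel M (val j) (s j) (omap s (path_parent j))
         (zeta (val j) (s j)) c.
apply: (stationary_marginal q) => // j s; rewrite /q.
by case: (hop_parent M i k == Some (val j)); [rewrite big_bool /=; field | exact: local_kernel_total].
Qed.

Variable rho : R.
Hypothesis rho_ge0 : 0 <= rho.
Hypothesis affine_policy : forall j, affine_agent M j (zeta j).
Hypothesis slope_lt1 : forall j, slope M j (zeta j) < 1.
Hypothesis shift_le : forall j,
  `|shift M j (zeta j) / (1 - slope M j (zeta j))| <= rho.

(** The induction runs down the path, from the [k]-hop parent ([d = 0]), where
both means lie in [0, 1], to [i] ([d = k]).  When the path ends earlier at the
root, the case [d = 0] is vacuous and the gap vanishes already at the root. *)
Lemma mean_gap d m (y : path_node M i k) :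
  (m + d)%N = k -> hop_parent M i m = Some (val y) ->
  `|marginal mu (val y) true - marginal nu y true| <= rho ^+ d.
Proof.
have [mu0 mu1 _] := mu_stat; have [_ nu1 _] := nu_stat.
elim: d m y => [|d IH] m y mdk hop_y.
  move: hop_y; rewrite -(addn0 m) mdk => hop_y.
  rewrite truncated_marginal hop_y eqxx -mulr_suml nu1 expr0.
  have := marginal_ge0 mu (val y) true mu0.
  have := marginal_ge0 mu (val y) false mu0.
  by rewrite (marginal_total _ _ mu1) ler_norml => ? ?; apply/andP; split; lra.
have mk : (m < k)%N by rewrite -mdk -addSnnS leq_addr.
have mean_y := truncated_marginal y true.
rewrite (negPf (hop_parent_inj _ _ _ _ _ mk hop_y)) in mean_y.
apply: le_trans (stationary_mean_contraction M _ _ _ _ (zeta (val y)) _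
  (parent M (val y)) _ (path_parent y) _ _ (shift_le _) mu1 nu1
  (global_marginal _ _) mean_y) _ => //.
rewrite exprS; apply: ler_wpM2l => //.
case par_y: (parent M (val y)) => [p|]; rewrite /path_parent par_y /=.
  have hop_p : hop_parent M i m.+1 = Some p by rewrite hop_parentS hop_y.
  have p_path := mem_path_to _ _ _ _ _ mk hop_p.
  rewrite (insubT (fun j => j \in path_to M i k) p_path) /=.
  by apply: (IH m.+1 (exist _ p p_path)); rewrite ?addSnnS.
by rewrite subrr normr0 exprn_ge0.
Qed.
End Decay.

Theorem lemma5 (R : realType) (n : nat) (M : instance R n) (rho : R)
  (hef : forall i : 'I_n.+1,
     te M i - tf M i = tg M i - th M i /\ -1 < te M i - tf M i < 1)
  (hef' : forall i : 'I_n.+1,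
     te M i - tf' M i = tg M i - th' M i /\ -1 < te M i - tf' M i < 1)
  (he'f : forall i : 'I_n.+1,
     te' M i - tf M i = tg' M i - th M i /\ -1 < te' M i - tf M i < 1)
  (he'f' : forall i : 'I_n.+1,
     te' M i - tf' M i = tg' M i - th' M i /\ -1 < te' M i - tf' M i < 1)
  (hrho : 0 < rho < 1)
  (hmax : forall i : 'I_n.+1,
     Num.max
       (Num.max `|(te M i - tg M i) / (1 - (te M i - tf M i))|
                `|(te M i - tg M i) / (1 - (te M i - tf' M i))|)
       (Num.max `|(te' M i - tg' M i) / (1 - (te' M i - tf M i))|
                `|(te' M i - tg' M i) / (1 - (te' M i - tf' M i))|) <= rho) :
  fast_decaying M 2 rho.
Proof.
have rho0 : 0 <= rho by case/andP: hrho => /ltW.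
(* The pair [(z false, z true)] of actions selects one of the four versions of
   each hypothesis. *)
have aff j z : affine_agent M j z.
  case: (hef j) (hef' j) (he'f j) (he'f' j) => [? _] [? _] [? _] [? _].
  by rewrite /affine_agent /slope; case: (z false) (z true) => [] [].
have slope1 j z : slope M j z < 1.
  case: (hef j) (hef' j) (he'f j) (he'f' j)
    => [_ /andP[_ ?]] [_ /andP[_ ?]] [_ /andP[_ ?]] [_ /andP[_ ?]].
  by rewrite /slope; case: (z false) (z true) => [] [].
have shift_rho j z : `|shift M j z / (1 - slope M j z)| <= rho.
  move: (hmax j); rewrite !ge_max => /andP[/andP[? ?] /andP[? ?]].
  by rewrite /shift /slope; case: (z false) (z true) => [] [].
move=> i zeta k _ mu mu_stat nu nu_stat.
have [_ mu1 _] := mu_stat; have [_ nu1 _] := nu_stat.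
have gap := mean_gap M zeta i k mu nu mu_stat nu_stat rho rho0
  (fun j => aff j (zeta j)) (fun j => slope1 j (zeta j))
  (fun j => shift_rho j (zeta j)) k 0 (start_node M i k) (add0n k) erefl.
rewrite /= in gap; rewrite /norm1 big_bool /= !marginal_total //.
set m := marginal mu _ _ in gap *; set m' := marginal nu _ _ in gap *.
have -> : 1 - m - (1 - m') = - (m - m') by ring.
by rewrite normrN; lra.
Qed.
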